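(* (a) For every $p>\frac12$ and $\varepsilon>0$ there is $\delta=\delta(p,\varepsilon)>0$ such that for every weighted majority function $f:\{0,1\}^n\to\{0,1\}$ (any $n$) and any probability distribution $\mu$ on $\{0,1\}^n$: if $e_k^\mu(f)\le\delta$ and $\mu[X_k=1]\ge p$ for all $k$, then $\mu[f]\ge1-\varepsilon$. In other words, if the effect of each variable is at most $\delta$ and the probability that each variable is $1$ is at least $p$, then $f=1$ with $\mu$-probability at least $1-\varepsilon$. (b) If $f:\{0,1\}^n\to\{0,1\}$ is a monotone anti-symmetric function but not a weighted majority function, then there exists a probability distribution $\mu$ on $\{0,1\}^n$ such that $\mu[X_k=1]>1/2$ for all $k$, yet $\mu[f]=0$ and $e_k^\mu(f)=0$ for all $k$. In other words, there is a probability measure $\mu$ for which $f=0$ with $\mu$-probability $1$, yet $\mu[X_k=1]>\frac12$ for all $k$ (since $f$ is constant according to $\mu$, all the effects are $0$ in this case). (c) If $f:\{0,1\}^n\to\{0,1\}$ is monotone, anti-symmetric and invariant under a transitive group, but is not the (simple) majority function, then there exists a probability distribution $\mu$ on $\{0,1\}^n$ such that $\mu[X_k=1]>1/2$ for all $k$, yet $\mu[f]=0$ and $e_k^\mu(f)=0$ for all $k$.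
   Context: A function $f:\{0,1\}^n\to\{0,1\}$ is monotone if it is non-decreasing in the coordinatewise order, and anti-symmetric if $f(1-x_1,\dots,1-x_n)=1-f(x_1,\dots,x_n)$ for all $x$. A monotone anti-symmetric $f$ is a weighted majority function if there exist non-negative weights $w_1,\dots,w_n$, not all zero, such that $f(x)=1$ whenever $\sum_i w_i(2x_i-1)>0$ and $f(x)=0$ whenever $\sum_i w_i(2x_i-1)<0$ (when the sum is $0$, the value of $f$ may be either $0$ or $1$ as long as $f$ is monotone and anti-symmetric). If $n$ is odd and $w_i=1$ for every $i$, $f$ is called the majority function (or simple majority). $f$ is invariant under a transitive group if there is a group $\Gamma$ of permutations of $\{1,\dots,n\}$ with $f(x_1,\dots,x_n)=f(x_{\sigma(1)},\dots,x_{\sigma(n)})$ for all $\sigma\in\Gamma$ and all $x$, and such that for all $1\le i,j\le n$ there is $\sigma\in\Gamma$ with $\sigma(i)=j$. For a probability distribution $\mu$ on $\{0,1\}^n$, $X=(X_1,\dots,X_n)$ denotes a sample from $\mu$, and $\mu[f]$ denotes the expected value of $f(X)$, i.e. the $\mu$-probability that $f=1$. The effect of the $k$-th variable on $f$ with respect to $\mu$ is $e_k^\mu(f)=\mu[f(X_1,\dots,X_n)\mid X_k=1]-\mu[f(X_1,\dots,X_n)\mid X_k=0]$ (difference of conditional expectations); it is undefined if the probability of $X_k=1$ is $0$ or $1$.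
   Formalization: In (c), for even n, unit-weight majorities with any monotone anti-symmetric tie-breaking also count as simple majority and are excluded; for them (e.g. n=6 with ties decided by a 2-(6,3,2) design) the conclusion is impossible. Odd n is unchanged. *)

(* Defs.v *)
From HB Require Import structures.
From mathcomp Require Import all_boot all_order all_algebra all_fingroup.
From mathcomp Require Import reals.

Set Implicit Arguments.
Unset Strict Implicit.
Unset Printing Implicit Defensive.

Import Order.TTheory GRing.Theory Num.Theory.

Local Open Scope ring_scope.

Definition cube (n : nat) : finType := {ffun 'I_n -> bool}.

Section BooleanFunctions.
Variables (R : realType) (n : nat).
Implicit Types (f : cube n -> bool) (x y : cube n) (w : 'I_n -> R).

Definition monotone f : Prop :=
  forall x y, (forall i, x i -> y i) -> f x -> f y.

Definition anti_symmetric f : Prop :=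
  forall x, f [ffun i => ~~ x i] = ~~ f x.

Definition weighted_vote w x : R := \sum_i w i * (2 * (x i)%:R - 1).

(* A zero vote leaves the value of f free, subject to monotonicity and
   anti-symmetry. *)
Definition weighted_majority_for w f : Prop :=
  [/\ monotone f /\ anti_symmetric f,
      forall i, 0 <= w i,
      exists i, w i != 0,
      forall x, 0 < weighted_vote w x -> f x = true
    & forall x, weighted_vote w x < 0 -> f x = false].

Definition weighted_majority f : Prop := exists w, weighted_majority_for w f.

(* For odd n no vote is zero, so this is exactly the majority function.
   For even n it holds of majority with any tie-breaking rule that is monotone
   and anti-symmetric.  Such a rule can be invariant under a transitive group
   (n = 6: a tied x has value 1 iff it is a block of the 2-(6,3,2) design), and
   then f = 0 forces at least half of the coordinates to be 0; these functions
   therefore have to count as simple majorities. *)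
Definition simple_majority f : Prop := weighted_majority_for (fun=> 1) f.

Definition invariant_under (G : {set 'S_n}) f : Prop :=
  forall s, s \in G -> forall x, f x = f [ffun i => x (s i)].

Definition invariant_under_transitive_group f : Prop :=
  exists2 G : {group 'S_n},
    [transitive G, on [set: 'I_n] | 'P] & invariant_under G f.

End BooleanFunctions.

Record distribution (R : realType) (T : finType) := Distribution {
  mass :> T -> R;
  mass_ge0 : forall x, 0 <= mass x;
  mass_sum1 : \sum_x mass x = 1
}.

Section Probability.
Variables (R : realType) (T : finType).
Implicit Types (mu : distribution R T) (A : pred T) (g : T -> R).

Definition prob mu A : R := \sum_(x | A x) mu x.

Definition expect mu g : R := \sum_x mu x * g x.

(* Meaningful only when prob mu A != 0. *)
Definition cond_expect mu g A : R := (\sum_(x | A x) mu x * g x) / prob mu A.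

End Probability.

Section Effects.
Variables (R : realType) (n : nat) (mu : distribution R (cube n)).
Implicit Types (f : cube n -> bool) (k : 'I_n).

Definition mean f : R := expect mu (fun x => (f x)%:R).

Definition marginal k : R := prob mu (fun x => x k).

(* None when the effect is undefined. *)
Definition effect f k : option R :=
  if 0 < marginal k < 1 then
    Some (cond_expect mu (fun x => (f x)%:R) (fun x => x k)
          - cond_expect mu (fun x => (f x)%:R) (fun x => ~~ x k))
  else None.

End Effects.

(* Main.v *)
Require Import Defs.
From mathcomp Require Import all_boot all_order all_algebra all_fingroup.
From mathcomp Require Import reals ring lra.

Set Implicit Arguments.
Unset Strict Implicit.
Unset Printing Implicit Defensive.

Import Order.TTheory GRing.Theory Num.Theory.

Local Open Scope ring_scope.

(** (a) The covariance of [f] and [X_k] is [q (1 - q)] times the effect of [k],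
    where [q] is the probability of [X_k = 1], hence at most [delta / 4].
    Averaging over [k] with the weights of [f], the weighted sum of the [X_k]
    restricted to [f = 0] has expectation at least [(p m - delta / 4) W], where
    [m] is the probability of [f = 0] and [W] the total weight; but it is at
    most [m W / 2], because the vote is nonpositive where [f = 0].

    (b) By Farkas' lemma, either some nonnegative combination of the vectors
    [2 x - 1] with [f x = 0] has all its coordinates at least 1, or some nonzero
    nonnegative [w] has a nonpositive vote wherever [f = 0].  The second
    alternative makes [f] a weighted majority, by anti-symmetry.

    (c) Averaging the votes over the group shows that an invariant weighted
    majority is a simple majority, so (b) applies. *)

(** * Farkas' lemma over an ordered field *)

(** Induction on [s], purely algebraic. The only hard case is a solution [w0] for the tail at which
    the new form [a i] is positive. *)
Lemma farkas (F : realFieldType) (I : eqType) (K : finType) (s : seq I)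
    (a : I -> K -> F) (b : K -> F) : uniq s ->
  (exists w : K -> F, (forall i, i \in s -> \sum_k a i k * w k <= 0) /\
                      0 < \sum_k b k * w k) \/
  (exists l : I -> F, (forall i, 0 <= l i) /\
                      forall k, b k = \sum_(i <- s) l i * a i k).
Proof.
elim: s a b => [|i s IHs] a b /=.
  move=> _; case: (boolP [forall k, b k == 0]) => [/forallP b0|].
    by right; exists (fun=> 0); split=> // k; rewrite big_nil; apply/eqP.
  rewrite negb_forall => /existsP[k bk]; left; exists b; split=> //.
  rewrite (bigD1 k) //= ltr_pwDl //.
    by rewrite lt0r mulf_neq0 // -expr2 sqr_ge0.
  by apply: sumr_ge0 => j _; rewrite -expr2 sqr_ge0.
move=> /andP[is_ us].
have extend (l : I -> F) c (g : I -> F) :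
    \sum_(j <- i :: s) (if j == i then c else l j) * g j =
    c * g i + \sum_(j <- s) l j * g j.
  rewrite big_cons eqxx; congr (_ + _).
  apply: eq_big_seq => j js; case: eqP => // ji.
  by move: is_; rewrite -ji js.
case: (IHs a b us) => [[w0 [w0a w0b]]|[l [l0 lb]]]; last first.
  right; exists (fun j => if j == i then 0 else l j); split=> [j|k].
    by case: eqP.
  by rewrite extend mul0r add0r lb.
set c := \sum_k a i k * w0 k; case: (lerP c 0) => [c0|c0].
  by left; exists w0; split=> // j; rewrite inE => /orP[/eqP->//|/w0a].
pose ev (d : K -> F) (w : K -> F) := \sum_k d k * w k.
(* The forms below are those of [a] and [b] precomposed with the projection
   along [w0] onto the kernel of [a i]. *)
pose proj (d : K -> F) k := d k - ev d w0 / c * a i k.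
have projE d w : ev (proj d) w = ev d (fun k => w k - ev (a i) w / c * w0 k).
  rewrite /ev /proj.
  under eq_bigr do rewrite mulrBl -(mulrA (ev d w0 / c)).
  under [RHS]eq_bigr do rewrite mulrBr mulrCA.
  by rewrite !sumrB -!mulr_sumr /ev; ring.
case: (IHs (fun j => proj (a j)) (proj b) us) => [[w [wa wb]]|[l [l0 lb]]].
  left; exists (fun k => w k - ev (a i) w / c * w0 k); split; last first.
    by have := projE b w; rewrite /ev => <-.
  move=> j; rewrite inE => /orP[/eqP->|js].
    under eq_bigr do rewrite mulrBr mulrCA.
    by rewrite sumrB -mulr_sumr -/c divfK ?gt_eqF // subrr.
  by have := projE (a j) w; rewrite /ev => <-; exact: wa.
(* Evaluating the desired identity at [w0] forces this coefficient of [a i]; it is nonnegative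
   because [b] is positive and the tail forms are nonpositive at [w0]. *)
right; pose d := (ev b w0 - \sum_(j <- s) l j * ev (a j) w0) / c.
exists (fun j => if j == i then d else l j); split=> [j|k].
  case: eqP => // _; rewrite divr_ge0 ?(ltW c0) // subr_ge0.
  apply: (@le_trans _ _ 0); last exact: ltW.
  by rewrite big_seq; apply: sumr_le0 => j' /w0a h; rewrite mulr_ge0_le0.
rewrite extend; have := lb k; rewrite /proj.
under eq_bigr do rewrite mulrBr.
rewrite sumrB => /eqP; rewrite subr_eq => /eqP ->.
under [X in _ - X]eq_bigr do rewrite !mulrA.
rewrite -!mulr_suml /d; ring.
Qed.

(** * Effect and covariance of a single variable *)

Section Distribution.
Variables (R : realType) (n : nat) (mu : distribution R (cube n)).
Implicit Types (f : cube n -> bool) (k : 'I_n).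

Lemma effect_covariance f k (delta : R) : 0 <= delta -> 0 < marginal mu k ->
  (forall e, effect mu f k = Some e -> e <= delta) ->
  marginal mu k * (1 - mean mu f) - delta / 4
    <= \sum_x mu x * (~~ f x)%:R * (x k)%:R.
Proof.
move=> d0 q0 eff.
pose a := \sum_(x : cube n | x k) mu x * (f x)%:R.
pose b := \sum_(x : cube n | ~~ x k) mu x * (f x)%:R.
pose q := marginal mu k.
have notq : prob mu (fun x => ~~ x k) = 1 - q.
  by rewrite -(mass_sum1 mu) (bigID (fun x : cube n => x k)) /= addrC addrK.
have mE : mean mu f = a + b by rewrite /mean /expect (bigID (fun x : cube n => x k)).
have -> : \sum_x mu x * (~~ f x)%:R * (x k)%:R = q - a.
  rewrite /q /marginal /prob /a -sumrB [RHS]big_mkcond /=.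
  by apply: eq_bigr => x _; case: (x k); case: (f x); rewrite /=; ring.
have b0 : 0 <= b by apply: sumr_ge0 => x _; rewrite mulr_ge0 ?mass_ge0.
have q1 : q <= 1.
  by rewrite -subr_ge0 -notq; apply: sumr_ge0 => x _; exact: mass_ge0.
rewrite -/q mE; suff : (1 - q) * a - q * b <= delta / 4 by lra.
(* If [q = 1] the effect is undefined and [eff] says nothing, but the covariance is then
   [- b <= 0]. *)
have [q_lt1|q_ge1] := ltrP q 1; last first.
  have -> : q = 1 by apply/eqP; rewrite eq_le q1.
  lra.
have := eff (a / q - b / (1 - q)).
rewrite /effect q0 q_lt1 /cond_expect notq => /(_ erefl) he.
have qq : 0 <= q * (1 - q) by rewrite mulr_ge0 ?subr_ge0 // ltW.
have -> : (1 - q) * a - q * b = q * (1 - q) * (a / q - b / (1 - q)).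
  have qn0 : q != 0 by rewrite gt_eqF.
  have q'n0 : 1 - q != 0 by rewrite gt_eqF ?subr_gt0.
  by field; rewrite qn0 q'n0.
apply: (le_trans (ler_wpM2l qq he)).
(* This is [q * (1 - q) <= 1 / 4]. *)
have : 0 <= (q - 2^-1) ^+ 2 by exact: sqr_ge0.
by move=> h; have := mulr_ge0 d0 h; lra.
Qed.

Lemma null_event_effect f k : (forall x, f x -> mu x = 0) ->
  0 < marginal mu k < 1 -> effect mu f k = Some 0.
Proof.
move=> mu0 qk; rewrite /effect qk /cond_expect.
have mf0 x : mu x * (f x)%:R = 0.
  by case: (boolP (f x)) => [/mu0->|_]; rewrite ?mul0r ?mulr0.
by rewrite !big1 // !mul0r subrr.
Qed.

End Distribution.

(** * Weighted votes and small effects *)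

Lemma weighted_voteE (R : realType) n (w : 'I_n -> R) (x : cube n) :
  weighted_vote w x = 2 * (\sum_k w k * (x k)%:R) - \sum_k w k.
Proof.
by rewrite /weighted_vote mulr_sumr -sumrB; apply: eq_bigr => k _; ring.
Qed.

Lemma weighted_vote_negb (R : realType) n (w : 'I_n -> R) (x : cube n) :
  weighted_vote w [ffun i => ~~ x i] = - weighted_vote w x.
Proof.
rewrite /weighted_vote -sumrN; apply: eq_bigr => i _; rewrite ffunE.
by case: (x i); rewrite /=; ring.
Qed.

Lemma sum_weights_gt0 (R : realType) n (w : 'I_n -> R) :
  (forall i, 0 <= w i) -> (exists i, w i != 0) -> 0 < \sum_i w i.
Proof.
move=> w0 [i wi]; rewrite (bigD1 i) //= ltr_pwDl //; first by rewrite lt0r wi w0.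
exact: sumr_ge0.
Qed.

Lemma weighted_majority_small_effects (R : realType) n (f : cube n -> bool)
    (mu : distribution R (cube n)) (p delta : R) :
  0 < p -> 0 <= delta -> weighted_majority R f ->
  (forall k e, effect mu f k = Some e -> e <= delta) ->
  (forall k, p <= marginal mu k) ->
  p * (1 - mean mu f) - delta / 4 <= (1 - mean mu f) / 2.
Proof.
move=> p0 d0 [w [_ w0 wn0 wpos _]] eff marg.
set m := 1 - mean mu f.
have mE : m = \sum_x mu x * (~~ f x)%:R.
  rewrite /m -[X in X - _](mass_sum1 mu) /mean /expect -sumrB.
  by apply: eq_bigr => x _; case: (f x); rewrite /=; ring.
have m0 : 0 <= m.
  by rewrite mE; apply: sumr_ge0 => x _; rewrite mulr_ge0 ?mass_ge0.
have W0 := sum_weights_gt0 w0 wn0.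
rewrite -(ler_pM2l W0).
apply: (@le_trans _ _ (\sum_k w k * \sum_x mu x * (~~ f x)%:R * (x k)%:R)).
  rewrite mulr_suml; apply: ler_sum => k _; apply: ler_wpM2l => //.
  apply: le_trans (effect_covariance d0 (lt_le_trans p0 (marg k)) (eff k)).
  by rewrite lerD2r ler_wpM2r.
under eq_bigr do rewrite mulr_sumr.
(* Once the sums are exchanged, the inequality holds point by point: both sides vanish where [f x]
   is true, and elsewhere the vote is nonpositive. *)
rewrite exchange_big /= mE [X in _ <= _ * X]mulr_suml mulr_sumr; apply: ler_sum => x _.
under eq_bigr do rewrite mulrCA.
rewrite -mulr_sumr [leRHS]mulrCA.
case: (boolP (f x)) => fx; first by rewrite /= !mulr0 !mul0r.
apply: ler_wpM2l; first by rewrite mulr_ge0 ?mass_ge0.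
suff : weighted_vote w x <= 0 by rewrite weighted_voteE; lra.
by rewrite leNgt; apply: contra fx => /wpos.
Qed.

(** * Distributions carried by the zeros of [f] *)

Section AntiSymmetric.
Variables (R : realType) (n : nat) (f : cube n -> bool).
Hypotheses (f_mono : monotone f) (f_anti : anti_symmetric f).

Let all0 : cube n := [ffun=> false].

Lemma anti_symmetric_monotone0 : f all0 = false.
Proof.
apply/negP => f0; have := f_anti all0; rewrite f0.
by rewrite (f_mono (x := all0)) // => i; rewrite ffunE.
Qed.

(** Complementing a point negates both its vote and its value, so control of the zeros of [f] gives
    control of its ones. *)
Lemma weighted_majority_nonpositive (w : 'I_n -> R) :
  (forall i, 0 <= w i) -> (exists i, w i != 0) ->
  (forall x, ~~ f x -> weighted_vote w x <= 0) -> weighted_majority_for w f.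
Proof.
move=> w0 wn0 wf; split=> // x vx.
  by apply/negPn/negP => /wf; rewrite leNgt vx.
apply/negP => fx; have := wf [ffun i => ~~ x i].
by rewrite f_anti fx weighted_vote_negb oppr_le0 leNgt vx => /(_ isT).
Qed.

(** Up to normalisation, [mu] is [l] on the zeros of [f] plus an atom at [all0]; a marginal exceeds
    1/2 iff the corresponding sum of [2 * (x k) - 1] is positive. *)
Lemma distribution_of_combination (l : cube n -> R) :
  (forall x, 0 <= l x) ->
  (forall k, 1 <= \sum_(x | ~~ f x) l x * (2 * (x k)%:R - 1)) ->
  exists mu : distribution R (cube n),
    [/\ forall k : 'I_n, 2^-1 < marginal mu k,
        mean mu f = 0
      & forall k : 'I_n, effect mu f k = Some 0].
Proof.
move=> l0 lk.
(* The mass added at [all0] keeps every marginal below 1. *)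
pose g x : R := (~~ f x)%:R * l x + (x == all0)%:R / 2.
have g0 x : 0 <= g x by rewrite /g addr_ge0 ?mulr_ge0 ?invr_ge0 ?ler0n.
have gf x : f x -> g x = 0.
  move=> fx; rewrite /g fx mul0r add0r; case: eqP => [xE|_].
    by move: fx; rewrite xE anti_symmetric_monotone0.
  by rewrite mul0r.
have ga0 : 0 < g all0 by rewrite /g eqxx ltr_wpDl ?mulr_ge0 ?divr_gt0.
pose G := \sum_x g x.
have G0 : 0 < G by rewrite /G (bigD1 all0) //= ltr_pwDl // sumr_ge0.
have mu0 x : 0 <= g x / G by rewrite divr_ge0 // ltW.
have mu1 : \sum_x g x / G = 1 by rewrite -mulr_suml divff ?gt_eqF.
pose mu := Distribution mu0 mu1.
have muf x : f x -> mu x = 0 by move=> /gf; rewrite /= => ->; rewrite mul0r.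
have margE k : marginal mu k = (\sum_(x : cube n | x k) g x) / G.
  by rewrite /marginal /prob /= mulr_suml.
have marg_gt k : 2^-1 < marginal mu k.
  rewrite margE ltr_pdivlMr //.
  suff : 0 < \sum_x g x * (2 * (x k)%:R - 1).
    have -> : \sum_x g x * (2 * (x k)%:R - 1)
            = 2 * (\sum_(x : cube n | x k) g x) - G.
      rewrite /G [X in 2 * X]big_mkcond mulr_sumr -sumrB; apply: eq_bigr => x _.
      by case: (x k); rewrite /=; ring.
    lra.
  (* The atom of mass 1/2 costs only half of the margin 1 granted by [lk]. *)
  have -> : \sum_x g x * (2 * (x k)%:R - 1)
          = \sum_(x | ~~ f x) l x * (2 * (x k)%:R - 1) - 2^-1.
    under eq_bigr do rewrite mulrDl.
    rewrite big_split /= [RHS]addrC addrC; congr (_ + _).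
      rewrite (bigD1 all0) //= eqxx ffunE big1 => [|x /negbTE->]; last first.
        by rewrite !mul0r.
      by rewrite /=; lra.
    rewrite [RHS]big_mkcond; apply: eq_bigr => x _.
    by case: (f x); rewrite /= ?mul1r ?mul0r.
  have := lk k; lra.
have marg_lt k : marginal mu k < 1.
  rewrite margE ltr_pdivrMr // mul1r /G [ltRHS](bigID (fun x : cube n => x k)) /=.
  by rewrite ltrDl (bigD1 all0) /= ?ffunE // ltr_pwDl // sumr_ge0.
exists mu; split=> // [|k].
  rewrite /mean /expect big1 // => x _.
  by case: (boolP (f x)) => [/muf->|_]; rewrite ?mul0r ?mulr0.
apply: null_event_effect => //.
by rewrite marg_lt andbT (lt_trans _ (marg_gt k)) ?invr_gt0.
Qed.

Lemma not_weighted_majority_distribution : ~ weighted_majority R f ->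
  exists mu : distribution R (cube n),
    [/\ forall k : 'I_n, 2^-1 < marginal mu k,
        mean mu f = 0
      & forall k : 'I_n, effect mu f k = Some 0].
Proof.
move=> nwm.
(* Adding the generators [- e_k] turns the equality of Farkas' lemma into the
   coordinatewise inequality that is needed. *)
pose a (i : cube n + 'I_n) (k : 'I_n) : R :=
  match i with
  | inl x => (~~ f x)%:R * (2 * (x k)%:R - 1)
  | inr j => - (k == j)%:R
  end.
have := farkas a (fun=> 1) (index_enum_uniq (cube n + 'I_n)%type).
case=> [[w [wa wb]]|[l [l0 lE]]]; last first.
  apply: (distribution_of_combination (l := fun x => l (inl x))) => // k.
  rewrite [leLHS](lE k) big_sumType /= -[leRHS]addr0 lerD //.
    rewrite [leRHS]big_mkcond ler_sum // => x _.
    by case: (f x); rewrite /= ?mul0r ?mulr0 ?mul1r.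
  by apply: sumr_le0 => j _; rewrite mulrN oppr_le0 mulr_ge0.
(* The forms [inr j] give [0 <= w j], the positive sum of [w] gives a nonzero weight, and the forms
   [inl x] give the votes. *)
case: nwm; exists w; apply: weighted_majority_nonpositive => [j||x fx].
- have := wa (inr j) (mem_index_enum _); rewrite (bigD1 j) //= eqxx big1.
    by rewrite addr0 mulN1r oppr_le0.
  by move=> k /negbTE->; rewrite oppr0 mul0r.
- apply/existsP; rewrite -negb_forall; apply/negP => /forallP w0.
  by move: wb; rewrite big1 ?ltxx // => k _; rewrite (eqP (w0 k)) mulr0.
have := wa (inl x) (mem_index_enum _); rewrite /= fx /weighted_vote.
by under eq_bigr do rewrite mul1r mulrC.
Qed.

End AntiSymmetric.

(** * Averaging over a transitive group *)

(** Translating by a group element that moves [i] to [j] shows that [c i] does not depend on [i], so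
    each weight multiplies the same number. *)
Lemma weighted_vote_orbit_sum (R : realType) n (G : {group 'S_n})
    (w : 'I_n -> R) (x : cube n) : [transitive G, on [set: 'I_n] | 'P] ->
  n%:R * (\sum_(s in G) weighted_vote w [ffun i => x (s i)])
  = #|G|%:R * (\sum_i w i) * weighted_vote (fun=> 1) x.
Proof.
move=> trG; pose c i : R := \sum_(s in G) (2 * (x (s i))%:R - 1).
have c_const i j : c i = c j.
  have /atransP2 := trG => /(_ i j (in_setT _) (in_setT _)) [t tG ->].
  rewrite /c (reindex_inj (mulgI t)) /=.
  by apply: eq_big => s; rewrite ?groupMl // => _; rewrite permM.
have sum_c : \sum_i c i = #|G|%:R * weighted_vote (fun=> 1) x.
  rewrite exchange_big /= mulr_natl -sumr_const; apply: eq_bigr => s _.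
  rewrite /weighted_vote [RHS](reindex_inj (@perm_inj _ s)) /=.
  by apply: eq_bigr => i _; rewrite mul1r.
rewrite mulrAC -sum_c exchange_big /= mulr_sumr mulr_sumr; apply: eq_bigr => i _.
under eq_bigr do rewrite ffunE.
rewrite -mulr_sumr -/(c i) (eq_bigr (fun=> c i)) => [|j _]; last exact: c_const.
by rewrite sumr_const card_ord -mulr_natl; ring.
Qed.

(** [f] is constant on the orbit of [x], so the votes there share a weak sign; their sum is a
    positive multiple of the unweighted vote. *)
Lemma transitive_weighted_majority (R : realType) n (f : cube n -> bool) :
  invariant_under_transitive_group f -> weighted_majority R f ->
  simple_majority R f.
Proof.
move=> [G trG invf] [w [fP w0 wn0 wpos wneg]].
have W0 := sum_weights_gt0 w0 wn0.
have n0 : 0 < n%:R :> R.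
  by case: wn0 => i _; rewrite ltr0n (leq_ltn_trans _ (ltn_ord i)).
have GW0 : 0 < #|G|%:R * \sum_i w i by rewrite mulr_gt0 ?ltr0n ?cardG_gt0.
split=> // [|x vx|x vx].
- by case: wn0 => i _; exists i; exact: oner_neq0.
- apply/negPn/negP => fx; have := mulr_gt0 GW0 vx.
  rewrite -(weighted_vote_orbit_sum _ _ trG) pmulr_rgt0 // ltNge => /negP[].
  apply: sumr_le0 => s sG; rewrite leNgt; apply: contra fx => /wpos.
  by rewrite -invf // => ->.
apply/negP => fx; have := vx; rewrite -(pmulr_rlt0 _ GW0).
rewrite -(weighted_vote_orbit_sum _ _ trG) pmulr_rlt0 // ltNge => /negP[].
apply: sumr_ge0 => s sG; rewrite leNgt; apply/negP => /wneg.
by rewrite -invf // fx.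
Qed.

Theorem theorem5p30 (R : realType) :
  [/\ (* (a) *)
      (forall p eps : R, 2^-1 < p -> 0 < eps ->
        exists2 delta : R, 0 < delta &
          forall (n : nat) (f : cube n -> bool) (mu : distribution R (cube n)),
            weighted_majority R f ->
            (forall (k : 'I_n) (e : R), effect mu f k = Some e -> e <= delta) ->
            (forall k : 'I_n, p <= marginal mu k) ->
            1 - eps <= mean mu f),
      (* (b) *)
      (forall (n : nat) (f : cube n -> bool),
        monotone f -> anti_symmetric f -> ~ weighted_majority R f ->
        exists mu : distribution R (cube n),
          [/\ forall k : 'I_n, 2^-1 < marginal mu k,
              mean mu f = 0
            & forall k : 'I_n, effect mu f k = Some 0])
    & (* (c) *)
      (forall (n : nat) (f : cube n -> bool),
        monotone f -> anti_symmetric f ->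
        invariant_under_transitive_group f -> ~ simple_majority R f ->
        exists mu : distribution R (cube n),
          [/\ forall k : 'I_n, 2^-1 < marginal mu k,
              mean mu f = 0
            & forall k : 'I_n, effect mu f k = Some 0])].
Proof.
split=> [p eps p_gt e0|n f f_mono f_anti|n f f_mono f_anti f_inv nsm].
- have d0 : 0 < p - 2^-1 by rewrite subr_gt0.
  (* The bound for small effects reads [(p - 1/2) * (1 - mean mu f) <= delta / 4]. *)
  exists (4 * (eps * (p - 2^-1))); first by rewrite !mulr_gt0.
  move=> n f mu wm eff marg.
  have p0 : 0 < p by lra.
  have de0 : 0 <= 4 * (eps * (p - 2^-1)) by rewrite !mulr_ge0 // ltW.
  have := weighted_majority_small_effects p0 de0 wm eff marg => h.
  suff : 1 - mean mu f <= eps by lra.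
  rewrite -(ler_pM2r d0); lra.
- exact: not_weighted_majority_distribution.
apply: not_weighted_majority_distribution => // wm; apply: nsm.
exact: transitive_weighted_majority.
Qed.
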